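(* Let $d\geq 1$ be real and let $\vec{X}=(X_1,\ldots,X_n)$ be an iid random vector whose entries satisfy $\mathbb{E}|X_1|^d<\infty$. Then $$\|A\|_{\vec{X},d}=\left(\frac{\mathbb{E}\,|\langle\vec{X},\boldsymbol{\lambda}(A)\rangle|^d}{\Gamma(d+1)}\right)^{1/d}$$ is a weakly unitarily invariant norm on $\mathrm{H}_n$. Moreover, if $m\geq 1$ and $\mathbb{E}|X_1|^m<\infty$, then for every $A\in\mathrm{H}_n$ the function $[1,m]\to\mathbb{R}$, $d\mapsto\|A\|_{\vec{X},d}$, is continuous.
   Context: An iid random vector is a random vector $\vec{X}=(X_1,\ldots,X_n)$ in $\mathbb{R}^n$ whose entries are independent, identically distributed, nondegenerate (not almost surely constant) real random variables. $\langle\cdot,\cdot\rangle$ is the standard inner product on $\mathbb{R}^n$ and $\Gamma$ is the gamma function. $\mathrm{H}_n$ is the real vector space of $n\times n$ complex Hermitian matrices; for $A\in\mathrm{H}_n$, $\boldsymbol{\lambda}(A)=(\lambda_1,\ldots,\lambda_n)$ is the vector of eigenvalues of $A$ with $\lambda_1\geq\cdots\geq\lambda_n$. A norm $\|\cdot\|$ on $\mathrm{H}_n$ is weakly unitarily invariant if $\|U^*AU\|=\|A\|$ for all $A\in\mathrm{H}_n$ and all unitary $U\in\mathrm{M}_n$. *)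

(* Defs.v *)
From HB Require Import structures.
From mathcomp Require Import all_boot all_order all_algebra.
From mathcomp Require Import all_classical all_reals all_analysis.
From mathcomp Require Import complex.
Unset Printing Implicit Defensive.
Import Order.TTheory GRing.Theory Num.Theory numFieldNormedType.Exports.
Local Open Scope ring_scope.
Local Open Scope classical_set_scope.

Definition RtoC {R : rcfType} (x : R) : R[i] := Complex x 0.

Definition mutually_independent {d : measure_display} {Omega : measurableType d}
  {R : realType} (P : probability Omega R) (n : nat)
  (X : 'I_n -> {RV P >-> R}) : Prop :=
  forall B : 'I_n -> set R, (forall i, measurable (B i)) ->
    P (\bigcap_(i in [set: 'I_n]) (X i @^-1` B i)) =
    (\prod_(i < n) P (X i @^-1` B i))%E.

Definition iid_random_vector {d : measure_display} {Omega : measurableType d}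
  {R : realType} (P : probability Omega R) (n : nat)
  (X : 'I_n.+1 -> {RV P >-> R}) : Prop :=
  [/\ mutually_independent P n.+1 X,
      (forall i (B : set R), measurable B -> P (X i @^-1` B) = P (X ord0 @^-1` B))
    & ~ (exists c : R, P (X ord0 @^-1` [set c]) = 1%E)].

Definition Gamma {R : realType} (s : R) : R :=
  Rintegral lebesgue_measure `]0, +oo[%classic (fun t => t `^ (s - 1) * expR (- t)).

Definition is_eigvals {R : rcfType} (n : nat) (A : 'M[R[i]]_n) (l : 'rV[R]_n) : Prop :=
  (forall i j : 'I_n, (i <= j)%N -> l 0 j <= l 0 i) /\
  char_poly A = \prod_(i < n) ('X - (RtoC (l 0 i))%:P).

Definition eigvals {R : realType} (n : nat) (A : 'M[R[i]]_n) : 'rV[R]_n :=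
  xget 0 [set l | is_eigvals n A l].

Definition Xnorm {d : measure_display} {Omega : measurableType d}
  {R : realType} (P : probability Omega R) (n : nat)
  (X : 'I_n -> {RV P >-> R}) (p : R) (A : 'M[R[i]]_n) : R :=
  let lam := eigvals n A in
  (fine (\int[P]_w ((`| \sum_(i < n) X i w * lam 0 i | `^ p)%:E)) / Gamma (p + 1))
    `^ (p^-1).

Local Open Scope sesquilinear_scope.

Definition is_norm_on_H {R : realType} (n : nat) (N : 'M[R[i]]_n -> R) : Prop :=
  [/\ (forall A, A \is hermsymmx -> 0 <= N A),
      (forall A, A \is hermsymmx -> N A = 0 -> A = 0),
      (forall (a : R) A, A \is hermsymmx -> N (RtoC a *: A) = `|a| * N A)
    & (forall A B, A \is hermsymmx -> B \is hermsymmx -> N (A + B) <= N A + N B)].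

Definition weakly_unitarily_invariant {R : realType} (n : nat)
  (N : 'M[R[i]]_n -> R) : Prop :=
  forall A U : 'M[R[i]]_n, A \is hermsymmx -> U \is unitarymx ->
    N (U ^t* *m A *m U) = N A.

(* Main.v *)
(* Weak unitary invariance is invariance of the spectrum under conjugation, and
   definiteness holds because a nondegenerate law has two support points: if
   <X, z> = 0 almost surely, replacing one coordinate by the other support point
   forces every z_i to vanish.
   For the triangle inequality, diagonalise A + B with eigenvalue vector y and
   read off the diagonals of A and B in an eigenbasis of A + B: y = S a + T b,
   where a, b are the eigenvalue vectors of A, B and S, T are doubly stochastic.
   Put c_i = E[X_i |Y|^(d-1) sgn Y] with Y = <X, y>, so that <c, y> = E|Y|^d and,
   by Young's inequality and scaling, <c, z> <= (E|Y|^d)^(1-1/d) (E|<X, z>|^d)^(1/d)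
   for all z. By Abel summation <c, S a> is at most <c, a o s> for some permutation
   s, and E|<X, a o s>|^d = E|<X, a>|^d because X is exchangeable; no appeal to
   Birkhoff's theorem is needed.
   Continuity in d follows by dominated convergence, since t^d <= 1 + t^m. *)
Require Import Defs.
From HB Require Import structures.
From mathcomp Require Import all_boot all_order all_algebra.
From mathcomp Require Import all_classical all_reals all_analysis.
From mathcomp Require Import perm complex measurable_realfun ring.
Import Order.TTheory GRing.Theory Num.Theory numFieldNormedType.Exports.
Local Open Scope ring_scope.
Local Open Scope classical_set_scope.
Local Open Scope sesquilinear_scope.

Set Implicit Arguments.
Unset Strict Implicit.

(** * Doubly stochastic matrices *)

(** The list of all indices, sorted by decreasing value of [f], is a permutation of the original
    list; [s] is that permutation. *)
Lemma sorting_perm (R : realDomainType) n (f : 'I_n -> R) :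
  exists s : 'S_n, forall i j : 'I_n, (i <= j)%N -> f (s j) <= f (s i).
Proof.
pose r : rel 'I_n := fun a b => f b <= f a.
have r_tot : total r by move=> a b; rewrite /r le_total.
have r_tr : transitive r by move=> a b c ba ac; apply: le_trans ac ba.
have r_refl : reflexive r by move=> a; rewrite /r lexx.
have /tuple_permP[s Es] : perm_eq (sort r (ord_tuple n)) (ord_tuple n).
  by rewrite perm_sort.
exists s => i j ij.
have := sort_sorted r_tot (ord_tuple n); rewrite Es => srt.
have k (l : 'I_n) : nth i [seq tnth (ord_tuple n) (s k) | k <- enum 'I_n] l = s l.
  by rewrite (nth_map i) ?size_enum_ord// nth_ord_enum tnth_ord_tuple.
have := sorted_leq_nth r_tr r_refl i srt (i : nat) (j : nat).
rewrite !inE size_tuple !ltn_ord => /(_ isT isT ij).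
by rewrite /= !k.
Qed.

Definition doubly_stochastic (R : numDomainType) n (S : 'M[R]_n) :=
  [/\ forall i j, 0 <= S i j, forall i, \sum_j S i j = 1
    & forall j, \sum_i S i j = 1].

Lemma doubly_stochastic_perm (R : numDomainType) n (S : 'M[R]_n) (s t : 'S_n) :
  doubly_stochastic S -> doubly_stochastic (\matrix_(i, j) S (s i) (t j)).
Proof.
move=> [S0 Sr Sc]; split=> [i j|i|j]; first by rewrite mxE.
- under eq_bigr do rewrite mxE.
  by rewrite -(Sr (s i)) [RHS](reindex_inj (@perm_inj _ t)).
- under eq_bigr do rewrite mxE.
  by rewrite -(Sc (t j)) [RHS](reindex_inj (@perm_inj _ s)).
Qed.

(** Abel summation: the weights are the consecutive drops of [f], and those with [j <= l] telescope
    to [f j - f ord_max]. *)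
Lemma nonincreasing_layers (R : realDomainType) n (f : 'I_n.+1 -> R) :
  (forall i j : 'I_n.+1, (i <= j)%N -> f j <= f i) ->
  exists2 a : 'I_n -> R, (forall l, 0 <= a l) &
    forall j, f j = f ord_max + \sum_(l < n) a l *+ (j <= l)%N.
Proof.
move=> fd; pose g k := f (inord k).
exists (fun l : 'I_n => g l - g l.+1) => [l|j].
  by rewrite subr_ge0 fd// !inordK ?ltnS// ltnW.
have -> : \sum_(l < n) (g l - g l.+1) *+ (j <= l)%N = g j - g n.
  rewrite (eq_bigr (fun l : 'I_n => if (j <= l)%N then g l - g l.+1 else 0)); last first.
    by move=> l _; case: leqP.
  rewrite -big_mkcond /= -opprB -(@telescope_sumr _ j n g); last by rewrite -ltnS.
  rewrite -sumrN big_geq_mkord; apply: eq_bigr => i _; by rewrite opprB.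
have gn : g n = f ord_max by congr f; apply: val_inj; rewrite /= inordK.
by rewrite gn /g inord_val addrC subrK.
Qed.

(* Writing g and x as nonnegative combinations of indicators of initial segments
   plus constants, which 1 - S annihilates, reduces the claim to the nonnegativity
   of the sums of 1 - S over the blocks [0, k] x [0, l]. *)
Lemma sorted_doubly_stochastic_le (R : realDomainType) n (S : 'M[R]_n)
    (g x : 'I_n -> R) : doubly_stochastic S ->
  (forall i j : 'I_n, (i <= j)%N -> g j <= g i) ->
  (forall i j : 'I_n, (i <= j)%N -> x j <= x i) ->
  \sum_i \sum_j g i * S i j * x j <= \sum_i g i * x i.
Proof.
case: n => [|n] in S g x *; first by rewrite !big_ord0.
move=> [S0 Sr Sc] /nonincreasing_layers[a a0 gE] /nonincreasing_layers[b b0 xE].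
pose D i j := (i == j)%:R - S i j.
have DN i j : i != j -> D i j <= 0.
  by move=> /negPf ij; rewrite /D ij sub0r oppr_le0.
have Dr i : \sum_j D i j = 0.
  rewrite sumrB Sr (bigD1 i)//= eqxx big1 ?addr0 ?subrr// => j ji.
  by rewrite eq_sym (negPf ji).
have Dc j : \sum_i D i j = 0.
  rewrite sumrB Sc (bigD1 j)//= eqxx big1 ?addr0 ?subrr// => i ji.
  by rewrite (negPf ji).
(* As the total is zero, an initial sum is minus the remaining tail, whose terms are nonpositive. *)
have tail_ge0 (v : 'I_n.+1 -> R) (k : nat) : \sum_i v i = 0 ->
    (forall i : 'I_n.+1, (k < i)%N -> v i <= 0) ->
    0 <= \sum_i v i *+ (i <= k)%N.
  move=> v0 vN; rewrite -[leRHS]subr0 -[X in _ - X]v0 -sumrB; apply: sumr_ge0 => i _.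
  by case: leqP => [|ki]; rewrite ?subrr// sub0r oppr_ge0 vN.
have abel (v z : 'I_n.+1 -> R) (c : 'I_n -> R) : \sum_i v i = 0 ->
    (forall i, z i = z ord_max + \sum_(l < n) c l *+ (i <= l)%N) ->
    \sum_i v i * z i = \sum_l c l * \sum_i v i *+ (i <= l)%N.
  move=> v0 zE; under eq_bigr do rewrite zE mulrDr.
  rewrite big_split/= -mulr_suml v0 mul0r add0r.
  under eq_bigr do rewrite mulr_sumr.
  rewrite exchange_big; apply: eq_bigr => l _; rewrite mulr_sumr.
  by apply: eq_bigr => i _; rewrite mulrnAr mulrnAr mulrC.
rewrite -subr_ge0 [leRHS](_ : _ = \sum_i (\sum_j D i j * x j) * g i); last first.
  rewrite -sumrB; apply: eq_bigr => i _; rewrite mulr_suml.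
  under [RHS]eq_bigr do rewrite mulrBl mulrBl.
  rewrite sumrB [in RHS](bigD1 i)//= eqxx [X in _ + X - _]big1 ?addr0 ?mul1r.
    rewrite (mulrC (x i)); congr (_ - _); apply: eq_bigr => j _.
    by rewrite mulrAC mulrC mulrA mulrAC.
  by move=> j; rewrite eq_sym => /negPf->; rewrite !mul0r.
rewrite (abel _ _ _ _ gE); last first.
  by rewrite exchange_big big1// => j _; rewrite -mulr_suml Dc mul0r.
apply: sumr_ge0 => k _; rewrite mulr_ge0//.
have -> : \sum_(i < n.+1) (\sum_j D i j * x j) *+ (i <= k)%N =
    \sum_(l < n) b l * \sum_i \sum_j D i j *+ (i <= k)%N *+ (j <= l)%N.
  under [RHS]eq_bigr do rewrite mulr_sumr.
  rewrite exchange_big; apply: eq_bigr => i _.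
  rewrite (abel _ _ _ (Dr i) xE) -sumrMnl; apply: eq_bigr => l _.
  rewrite -mulrnAr -sumrMnl; congr (_ * _); apply: eq_bigr => j _.
  by rewrite mulrnAC.
apply: sumr_ge0 => l _; rewrite mulr_ge0//.
(* If [k <= l], each row [i <= k] keeps its diagonal entry, so the entries dropped beyond column [l]
   are off-diagonal and [tail_ge0] applies row by row; otherwise the same argument runs column by
   column. *)
have [kl|lk] := leqP k l.
- apply: sumr_ge0 => i _; under eq_bigr do rewrite mulrnAC.
  rewrite sumrMnl; case: leqP => // ik; apply: tail_ge0 => // j lj.
  by apply: DN; rewrite -val_eqE ltn_eqF// (leq_ltn_trans ik)// (leq_ltn_trans kl).
- rewrite exchange_big; apply: sumr_ge0 => j _.
  rewrite sumrMnl; case: leqP => // jl; apply: tail_ge0 => // i ki.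
  by apply: DN; rewrite -val_eqE gtn_eqF// (leq_ltn_trans jl)// (ltn_trans lk).
Qed.

Lemma doubly_stochastic_rearrangement (R : realDomainType) n (S : 'M[R]_n)
    (g x : 'I_n -> R) : doubly_stochastic S ->
  exists s : 'S_n, \sum_i \sum_j g i * S i j * x j <= \sum_i g i * x (s i).
Proof.
move=> dS; have [t gt] := sorting_perm g; have [u xu] := sorting_perm x.
(* This permutation sends the index holding a given rank in [g] to the index holding the same rank
   in [x]. *)
exists (t^-1 * u)%g.
rewrite [leRHS](reindex_inj (@perm_inj _ t))/= (reindex_inj (@perm_inj _ t))/=.
under [leRHS]eq_bigr do rewrite permM permK.
have := sorted_doubly_stochastic_le (doubly_stochastic_perm t u dS) gt xu.
congr (is_true (_ <= _)); apply: eq_bigr => i _.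
rewrite [RHS](reindex_inj (@perm_inj _ u))/=.
by apply: eq_bigr => j _; rewrite mxE.
Qed.

(** * Spectra of Hermitian matrices *)

Lemma char_poly_similar (F : comUnitRingType) n (P A : 'M[F]_n) :
  P \in unitmx -> char_poly (invmx P *m A *m P) = char_poly A.
Proof.
move=> Pu; rewrite /char_poly.
have -> : char_poly_mx (invmx P *m A *m P) =
    map_mx polyC (invmx P) *m char_poly_mx A *m map_mx polyC P.
  rewrite /char_poly_mx mulmxBr mulmxBl -!map_mxM; congr (_ - _).
  by rewrite scalar_mxC -mulmxA -map_mxM mulVmx// map_mx1 mulmx1.
by rewrite !det_mulmx mulrC mulrA -det_mulmx -map_mxM mulmxV// map_mx1 det1 mul1r.
Qed.

(** Row sums are the diagonal entries of [W *m W^t*]; column sums come in the same way from the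
    unitary matrix [W^T]. Moduli are elements of [R[i]], hence [complex.Re], which loses nothing by
    [ReE]. *)
Lemma doubly_stochastic_unitary (R : rcfType) n (W : 'M[R[i]]_n) :
  W \is unitarymx ->
  doubly_stochastic (\matrix_(i, j) complex.Re (`|W i j| ^+ 2)).
Proof.
have ReE (z : R[i]) : RtoC (complex.Re (`|z| ^+ 2)) = z * z^*.
  by rewrite -normCK; apply: RRe_real; rewrite rpredX// normr_real.
move=> Wu; split=> [i j|i|j].
- rewrite mxE -(@ler0c R).
  by rewrite [X in 0 <= X]ReE mul_conjC_ge0.
- apply: (@complexI R); rewrite rmorph_sum rmorph1/=.
  have /unitarymxP/matrixP/(_ i i) := Wu; rewrite !mxE eqxx mulr1n => <-.
  by apply: eq_bigr => j _; rewrite !mxE -ReE.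
- have : W^T \is unitarymx by rewrite trmx_unitary.
  move=> /unitarymxP/matrixP/(_ j j); rewrite !mxE eqxx mulr1n => H.
  apply: (@complexI R); rewrite rmorph_sum rmorph1/= -H.
  by apply: eq_bigr => i _; rewrite !mxE -ReE.
Qed.

Lemma unitary_diag_entry (R : rcfType) n (W : 'M[R[i]]_n) (x : 'rV[R]_n) i :
  (W *m diag_mx (map_mx RtoC x) *m W^t*) i i =
  RtoC (\sum_j complex.Re (`|W i j| ^+ 2) * x 0 j).
Proof.
rewrite mul_mx_diag mxE [RHS](rmorph_sum (real_complex R)).
apply: eq_bigr => j _; rewrite !mxE [RHS](rmorphM (real_complex R)).
rewrite mulrAC -normCK; congr (_ * _).
by apply/esym/RRe_real; rewrite rpredX// normr_real.
Qed.

(** Conjugating by [U] makes the right-hand side diagonal. The matrices [S] and [T] hold the squared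
    moduli of the transition matrices [U *m V^t*] and [U *m W^t*]. *)
Lemma unitary_diag_add (R : rcfType) n (U V W : 'M[R[i]]_n) (y a b : 'rV[R]_n) :
  U \is unitarymx -> V \is unitarymx -> W \is unitarymx ->
  V^t* *m diag_mx (map_mx RtoC a) *m V + W^t* *m diag_mx (map_mx RtoC b) *m W =
  U^t* *m diag_mx (map_mx RtoC y) *m U ->
  exists S T : 'M[R]_n, [/\ doubly_stochastic S, doubly_stochastic T &
    forall i, y 0 i = \sum_j S i j * a 0 j + \sum_j T i j * b 0 j].
Proof.
move=> Uu Vu Wu E.
have transition (T : 'M[R[i]]_n) (c : 'rV[R]_n) : T \is unitarymx ->
    exists2 S : 'M[R]_n, doubly_stochastic S & forall i,
      (U *m (T^t* *m diag_mx (map_mx RtoC c) *m T) *m U^t*) i i =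
      RtoC (\sum_j S i j * c 0 j).
  move=> Tu; have Tu' : T^t* \is unitarymx by rewrite trmxC_unitary.
  have UTu : U *m T^t* \is unitarymx by exact: mul_unitarymx.
  eexists; first exact: doubly_stochastic_unitary UTu.
  move=> i; under eq_bigr do rewrite mxE.
  by rewrite -unitary_diag_entry trmx_mul map_mxM trmxCK !mulmxA.
have [S dS SE] := transition V a Vu; have [T dT TE] := transition W b Wu.
exists S, T; split=> // i; apply: (@complexI R).
rewrite [RHS](rmorphD (real_complex R)) -[X in _ = X + _]SE -[X in _ = _ + X]TE.
have -> (M N : 'M[R[i]]_n) : M i i + N i i = (M + N) i i by rewrite mxE.
rewrite -mulmxDl -mulmxDr E !mulmxA (unitarymxP Uu) mul1mx.
by rewrite mulmxtVK// !mxE eqxx.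
Qed.

Section eigvals.
Variables (R : realType) (n : nat).
Implicit Types (A U : 'M[R[i]]_n) (x : 'rV[R]_n).

Lemma hermitian_unitary_diag A : A \is hermsymmx ->
  exists U x, U \is unitarymx /\ A = U^t* *m diag_mx (map_mx RtoC x) *m U.
Proof.
move=> Ah; exists (spectralmx A), (map_mx (@complex.Re R) (spectral_diag A)).
split; first exact: spectral_unitarymx.
have /orthomx_spectralP := hermitian_normalmx Ah.
rewrite invmx_unitary ?spectral_unitarymx// => {1}->.
congr (_ *m diag_mx _ *m _); apply/rowP => j; rewrite !mxE.
apply/esym/RRe_real; have /mxOverP := hermitian_spectral_diag_real Ah.
exact.
Qed.

Lemma char_poly_unitary_diag A U x : U \is unitarymx ->
  A = U^t* *m diag_mx (map_mx RtoC x) *m U ->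
  char_poly A = \prod_i ('X - (RtoC (x 0 i))%:P).
Proof.
move=> Uu ->; rewrite -invmx_unitary// char_poly_similar ?unitarymx_unit//.
rewrite char_poly_trig ?diag_mx_is_trig//.
by apply: eq_bigr => i _; rewrite !mxE eqxx.
Qed.

Lemma eigvals_unitary_diag A U x : U \is unitarymx ->
  A = U^t* *m diag_mx (map_mx RtoC x) *m U ->
  exists s : 'S_n, forall i, eigvals n A 0 i = x 0 (s i).
Proof.
move=> Uu AE; have cA := char_poly_unitary_diag Uu AE.
(* Since [eigvals] is an [xget] with default 0, its specification is available only after a witness
   is exhibited: here [x] sorted by [t]. *)
have : is_eigvals n A (eigvals n A).
  have [t xt] := sorting_perm (x 0).
  apply: (xgetPex 0 (P := is_eigvals n A)); exists (\row_i x 0 (t i)); split.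
    by move=> i j ij; rewrite !mxE xt.
  rewrite cA (reindex_inj (@perm_inj _ t))/=.
  by apply: eq_bigr => i _; rewrite !mxE.
have prodE (v : 'rV[R]_n) : \prod_i ('X - (RtoC (v 0 i))%:P) =
    \prod_(c <- [tuple RtoC (v 0 i) | i < n]) ('X - c%:P).
  by rewrite /= big_map big_enum.
move=> [_]; rewrite cA !prodE => /prod_XsubC_eq.
rewrite perm_sym => /tuple_permP[s E]; exists s => i.
have nthE (f : 'I_n -> R[i]) : nth 0 [seq f j | j <- enum 'I_n] i = f i.
  by rewrite (nth_map i) ?size_enum_ord// nth_ord_enum.
have := congr1 (fun u : seq R[i] => nth 0 u i) E.
rewrite /= !nthE tnth_mktuple.
exact: complexI.
Qed.

(** The predicate [is_eigvals] sees the matrix only through its characteristic polynomial, so both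
    choices are made from the same set. *)
Lemma eigvals_unitary_conj A U : U \is unitarymx ->
  eigvals n (U^t* *m A *m U) = eigvals n A.
Proof.
move=> Uu; rewrite /eigvals; congr xget; apply/funext => l; apply/propext.
by rewrite /is_eigvals -invmx_unitary// char_poly_similar// unitarymx_unit.
Qed.

End eigvals.

(** * Exchangeability *)

Lemma measurable_norm_powR d (T : measurableType d) (R : realType)
    (f : T -> R) (p : R) :
  measurable_fun setT f -> measurable_fun setT (fun x => `|f x| `^ p).
Proof.
move=> mf; apply: (@measurableT_comp _ _ _ _ _ _ (@powR R ^~ p)) => //.
exact: measurableT_comp.
Qed.

Section exchangeability.
Context d0 (Omega : measurableType d0) (R : realType) (P : probability Omega R).

(** A pi-system generating the product sigma-algebra, on which independence determines the joint
    law. *)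
Definition rectangles n : set (set (n.-tuple R)) :=
  [set A | exists2 B : 'I_n -> set R, (forall i, measurable (B i)) &
    A = \bigcap_(i in [set: 'I_n]) ((@tnth n R)^~ i @^-1` B i)].

Lemma measurable_rectangle n : @rectangles n `<=` measurable.
Proof.
move=> _ [B mB ->]; apply: fin_bigcap_measurable => [|i _].
  exact: finite_finset.
by rewrite -[X in measurable X]setTI; apply: measurable_tnth.
Qed.

Lemma measurable_tuple_rectangles n :
  @measurable _ (n.-tuple R) = <<s @rectangles n >>.
Proof.
apply/seteqP; split.
- apply: smallest_sub; first exact: smallest_sigma_algebra.
  move=> A; rewrite -bigcup_seq/= => -[i _] [B mB <-].
  apply: sub_sigma_algebra; exists (fun j => if j == i then B else setT).
    by move=> j; case: eqP.
  rewrite setTI; apply/seteqP; split=> t /= Bt.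
    by move=> j _ /=; case: eqP => // ->.
  by have := Bt i I; rewrite /= eqxx.
- apply: smallest_sub; first exact: sigma_algebra_measurable.
  exact: measurable_rectangle.
Qed.

(** Uniqueness of measures on a generating pi-system. The whole space is a rectangle of finite
    measure, so a constant sequence exhausts it. *)
Lemma eq_measure_rectangles n (m1 m2 : {measure set (n.-tuple R) -> \bar R}) :
  (m1 setT < +oo)%E -> (forall A, @rectangles n A -> m1 A = m2 A) ->
  forall A, measurable A -> m1 A = m2 A.
Proof.
move=> m1oo m12; apply: (measure_unique (@rectangles n) (fun=> setT)) => //.
- exact: measurable_tuple_rectangles.
- move=> _ _ [B mB ->] [C mC ->]; exists (fun i => B i `&` C i).
    by move=> i; exact: measurableI.
  apply/seteqP; split=> t /=.
    by move=> [Bt Ct] i _; split; [exact: Bt|exact: Ct].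
  by move=> BCt; split=> i _; have [] := BCt i I.
- by move=> _; exists (fun=> setT) => //; rewrite bigcapT.
- by rewrite bigcup_const.
Qed.

Lemma measurable_joint n (X : 'I_n -> {RV P >-> R}) :
  measurable_fun [set: Omega] (fun w => [tuple X i w | i < n]).
Proof.
apply/measurable_fun_tnthP => i.
rewrite (_ : _ \o _ = X i) => [|]; first exact: measurable_funP.
by apply/funext => w /=; rewrite tnth_mktuple.
Qed.

Definition joint n (X : 'I_n -> {RV P >-> R}) : {RV P >-> n.-tuple R} :=
  HB.pack_for {RV P >-> n.-tuple R} (fun w => [tuple X i w | i < n])
    (isMeasurableFun.Build _ _ _ _ _ (measurable_joint X)).

Lemma distribution_joint_rectangle n (X : 'I_n -> {RV P >-> R})
    (B : 'I_n -> set R) :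
  distribution P (joint X)
    (\bigcap_(i in [set: 'I_n]) ((@tnth n R)^~ i @^-1` B i)) =
  P (\bigcap_(i in [set: 'I_n]) (X i @^-1` B i)).
Proof.
congr (P _).
by apply/seteqP; split=> w Bw i _; have := Bw i I; rewrite /= tnth_mktuple.
Qed.

(** On a rectangle, permuting the variables only permutes the sides, and for identical laws the
    product of the marginal probabilities does not change. *)
Lemma distribution_joint_perm n (X : 'I_n.+1 -> {RV P >-> R}) (s : 'S_n.+1) :
  iid_random_vector P n X -> forall A, measurable A ->
  distribution P (joint X) A = distribution P (joint (X \o s)) A.
Proof.
move=> [indX idX _]; apply: eq_measure_rectangles.
  by rewrite [ltLHS]probability_setT ltry.
move=> _ [B mB ->]; apply: (etrans (distribution_joint_rectangle X B)).
apply/esym/(etrans (distribution_joint_rectangle (X \o s) B)).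
have -> : \bigcap_(i in [set: 'I_n.+1]) ((X \o s) i @^-1` B i) =
    \bigcap_(i in [set: 'I_n.+1]) (X i @^-1` B (s^-1%g i)).
  apply/seteqP; split=> w Bw i _.
    by have := Bw (s^-1%g i) I; rewrite /= permKV.
  by have := Bw (s i) I; rewrite /= permK.
rewrite !indX// (reindex_inj (@perm_inj _ s))/=.
by apply: eq_bigr => i _; rewrite permK [RHS]idX// idX.
Qed.

Lemma eq_integral_joint_perm n (X : 'I_n.+1 -> {RV P >-> R}) (s : 'S_n.+1)
    (f : n.+1.-tuple R -> \bar R) :
  iid_random_vector P n X ->
  @measurable_fun _ _ (n.+1.-tuple R) (\bar R) setT f ->
  (forall t, 0 <= f t)%E ->
  (\int[P]_w f [tuple X i w | i < n.+1] =
   \int[P]_w f [tuple X (s i) w | i < n.+1])%E.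
Proof.
move=> hX mf f0.
have := ge0_integral_distribution (joint X) mf f0.
have := ge0_integral_distribution (joint (X \o s)) mf f0.
rewrite /comp/= => <- <-.
apply: eq_measure_integral => A mA _.
exact: distribution_joint_perm.
Qed.

End exchangeability.

Definition lincomb d0 (Omega : measurableType d0) (R : realType)
    (P : probability Omega R) n (X : 'I_n -> {RV P >-> R}) (z : 'rV[R]_n)
    (w : Omega) : R := \sum_(i < n) X i w * z 0 i.

Section lincomb.
Context d0 (Omega : measurableType d0) (R : realType) (P : probability Omega R).
Variables (n : nat) (X : 'I_n.+1 -> {RV P >-> R}).
Hypothesis hX : iid_random_vector P n X.

Lemma measurable_lincomb z : measurable_fun setT (lincomb X z).
Proof.
by apply: measurable_sum => i; apply: measurable_funM => //; exact: measurable_funP.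
Qed.

Lemma integral_lincomb_perm (s : 'S_n.+1) (p : R) (z : 'rV[R]_n.+1) :
  (\int[P]_w (`|lincomb X (\row_i z 0 (s i)) w| `^ p)%:E =
   \int[P]_w (`|lincomb X z w| `^ p)%:E)%E.
Proof.
pose f (t : n.+1.-tuple R) := (`|\sum_i tnth t i * z 0 i| `^ p)%:E.
have mf : @measurable_fun _ _ (n.+1.-tuple R) (\bar R) setT f.
  apply/measurable_EFinP/measurable_norm_powR.
  apply: measurable_sum => i; apply: measurable_funM => //.
  exact: measurable_tnth.
(* Reindexing moves the permutation from the coefficients to the variables, where it becomes
   [s^-1]. *)
transitivity (\int[P]_w f [tuple X ((s^-1)%g i) w | i < n.+1])%E.
  apply: eq_integral => w _; congr (`|_| `^ p)%:E.
  rewrite [RHS](reindex_inj (@perm_inj _ s))/=.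
  by apply: eq_bigr => i _; rewrite mxE tnth_mktuple permK.
rewrite -(eq_integral_joint_perm _ hX mf); last by move=> t; rewrite lee_fin powR_ge0.
apply: eq_integral => w _; congr (`|_| `^ p)%:E.
by apply: eq_bigr => i _; rewrite tnth_mktuple.
Qed.

End lincomb.

(** * Moments and definiteness *)

(** A crude bound through the largest term; its only purpose is integrability, so the constant does
    not matter. *)
Lemma powR_sum_le (R : realType) n (a : 'I_n.+1 -> R) (p : R) :
  0 <= p -> (forall i, 0 <= a i) ->
  (\sum_i a i) `^ p <= n.+1%:R `^ p * \sum_i a i `^ p.
Proof.
move=> p0 a0; have [k _ ak] := @arg_maxP _ _ _ ord0 xpredT a isT.
apply: (@le_trans _ _ ((n.+1%:R * a k) `^ p)).
  rewrite ge0_ler_powR ?nnegrE ?mulr_ge0 ?sumr_ge0//.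
  rewrite mulr_natl -[in leRHS](card_ord n.+1) -sumr_const.
  by apply: ler_sum => i _; exact: ak.
rewrite powRM// ler_wpM2l ?powR_ge0// (bigD1 k)//= lerDl.
by apply: sumr_ge0 => i _; exact: powR_ge0.
Qed.

Section moments.
Context d0 (Omega : measurableType d0) (R : realType) (P : probability Omega R).
Variables (n : nat) (X : 'I_n.+1 -> {RV P >-> R}).
Hypothesis hX : iid_random_vector P n X.
Variable p : R.
Hypothesis p0 : 0 <= p.
Hypothesis Xp : (\int[P]_w ((`| X ord0 w | `^ p)%:E) < +oo)%E.

Lemma integrable_powR i : P.-integrable setT (fun w => (`| X i w | `^ p)%:E).
Proof.
have [_ idX _] := hX.
have mp : measurable_fun setT (fun x : R => (`|x| `^ p)%:E).
  by apply/measurable_EFinP/measurable_norm_powR; exact: measurable_id.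
have fp (x : R) : (0 <= (`|x| `^ p)%:E)%E by rewrite lee_fin powR_ge0.
apply/integrableP; split.
  apply/measurable_EFinP/measurable_norm_powR; exact: measurable_funP.
under eq_integral do rewrite gee0_abs//.
have := ge0_integral_distribution (X i) mp fp; rewrite /comp/= => <-.
rewrite (eq_measure_integral (distribution P (X ord0)))//; last first.
  by move=> A mA _; exact: idX.
by have := ge0_integral_distribution (X ord0) mp fp; rewrite /comp/= => ->.
Qed.

Lemma integrable_lincomb z :
  P.-integrable setT (fun w => (`| lincomb X z w | `^ p)%:E).
Proof.
pose C i := n.+1%:R `^ p * `|z 0 i| `^ p.
apply: (@le_integrable _ _ _ _ _ _ _
    (fun w => \sum_i (C i)%:E * (`|X i w| `^ p)%:E)%E) => //.
- exact/measurable_EFinP/measurable_norm_powR/measurable_lincomb.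
- move=> w _; rewrite sumEFin !abse_EFin lee_fin ger0_norm ?powR_ge0//.
  rewrite ger0_norm; last first.
    by apply: sumr_ge0 => i _; rewrite !mulr_ge0 ?powR_ge0.
  have -> : \sum_i C i * `|X i w| `^ p =
      n.+1%:R `^ p * \sum_i (`|X i w * z 0 i|) `^ p.
    rewrite mulr_sumr; apply: eq_bigr => i _.
    by rewrite normrM powRM// mulrAC mulrA.
  apply: le_trans (powR_sum_le p0 _) => //.
  by rewrite ge0_ler_powR ?nnegrE ?sumr_ge0// ler_norm_sum.
- apply: integrable_sum => // i _; apply: integrableZl => //.
  exact: integrable_powR.
Qed.

Definition moment z := \int[P]_w (`| lincomb X z w | `^ p).

Lemma moment_ge0 z : 0 <= moment z.
Proof. by apply: Rintegral_ge0 => w _; exact: powR_ge0. Qed.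

End moments.

Section nondegenerate.
Context d0 (Omega : measurableType d0) (R : realType) (P : probability Omega R).

(* U is the union of the preimages of the rational intervals of measure zero. *)
Lemma support_outside_negligible (X : {RV P >-> R}) :
  exists2 U, P.-negligible U &
    forall w, ~ U w -> forall e, 0 < e -> (0 < P (X @^-1` (ball (X w) e)))%E.
Proof.
pose F k : set Omega := if (unpickle k : option (rat * rat)) is Some (r, s) then
  [set w | P (X @^-1` `]ratr r, ratr s[) = 0%E /\ (X @^-1` `]ratr r, ratr s[) w]
  else set0.
exists (\bigcup_k F k).
  apply: negligible_bigcup => k; rewrite /F.
  case: unpickle => [[r s]|]; last exact: negligible_set0.
  have [P0|P0] := pselect (P (X @^-1` `]ratr r, ratr s[) = 0%E).
    exists (X @^-1` `]ratr r, ratr s[); split=> //; last by move=> w [].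
    exact: measurable_funPTI.
  rewrite [X in _.-negligible X](_ : _ = set0); first exact: negligible_set0.
  by apply/seteqP; split=> v // -[].
move=> w Uw e e0; rewrite lt0e measure_ge0 andbT; apply/negP => /eqP P0.
apply: Uw.
have /rat_in_itvoo[r] : X w - e < X w by rewrite ltrBlDr ltrDl.
have /rat_in_itvoo[s] : X w < X w + e by rewrite ltrDl.
rewrite !in_itv/= => /andP[ws se] /andP[er rw].
suff : [set w | P (X @^-1` `]ratr r, ratr s[) = 0%E /\ (X @^-1` `]ratr r, ratr s[) w] w.
  by move=> Frs; exists (pickle (r, s)); [exact: I|rewrite /F pickleK; exact: Frs].
split; last by rewrite /= in_itv/= rw.
apply/eqP; rewrite -measure_le0 -P0 le_measure ?inE//.
- exact: measurable_funPTI.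
- by apply: measurable_funPTI => //; exact: measurable_ball.
- move=> v; rewrite /= in_itv/= => /andP[rv vs]; rewrite /ball/= ltr_distlC.
  by rewrite (lt_trans er)// (lt_trans vs).
Qed.

(** Off a negligible set every value of [X] is a support point. If all these values coincided, [X]
    would be almost surely constant. *)
Lemma two_support_points (X : {RV P >-> R}) :
  ~ (exists c : R, P (X @^-1` [set c]) = 1%E) ->
  exists a b, a != b /\
    forall x, x = a \/ x = b -> forall e, 0 < e -> (0 < P (X @^-1` ball x e))%E.
Proof.
move=> ndX; have [U nU supp] := support_outside_negligible X.
have [w Uw] : exists w, ~ U w.
  apply: contrapT => /forallNP nex.
  have : P setT = 0%E.
    apply/negligibleP => //.
    by apply: negligibleS nU => w _; apply: contrapT; exact: nex.
  by rewrite probability_setT => /eqP; rewrite onee_eq0.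
have [v [Uv vw]] : exists v, ~ U v /\ X v != X w.
  apply: contrapT => /forallNP nex; apply: ndX; exists (X w).
  have mw : measurable (X @^-1` [set X w]) by exact: measurable_funPTI.
  have mw' : measurable (~` (X @^-1` [set X w])) by exact: measurableC.
  have H : P (~` (X @^-1` [set X w])) = 0%E.
    apply/negligibleP => //; apply: negligibleS nU => v /= vw.
    apply: contrapT => Uv; apply: (nex v); split=> //; exact/eqP.
  by rewrite -[X in P X]setCK probability_setC ?H ?sube0.
exists (X w), (X v); split; first by rewrite eq_sym.
by move=> x [] -> e e0; exact: supp.
Qed.

End nondegenerate.

Section definiteness.
Context d0 (Omega : measurableType d0) (R : realType) (P : probability Omega R).
Variables (n : nat) (X : 'I_n.+1 -> {RV P >-> R}).
Hypothesis hX : iid_random_vector P n X.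

Lemma ball_box_gt0 (v : 'I_n.+1 -> R) (e : R) :
  (forall i, 0 < P (X ord0 @^-1` ball (v i) e))%E ->
  (0 < P (\bigcap_(i in [set: 'I_n.+1]) (X i @^-1` ball (v i) e)))%E.
Proof.
have [indX idX _] := hX => v0.
rewrite indX; last by move=> i; exact: measurable_ball.
elim/big_ind : _ => [|x y|i _]; [exact: lte01|exact: mule_gt0|].
by rewrite idX//; exact: measurable_ball.
Qed.

Lemma lincomb_ae_eq0 (z : 'rV[R]_n.+1) :
  {ae P, forall w, lincomb X z w = 0} -> z = 0.
Proof.
move=> Xz0; have [indX idX ndX] := hX.
have [a [b [ab supp]]] := two_support_points ndX.
(* The vector [X] lies close to [v] with positive probability, so some such outcome also satisfies
   $\langle X, z\rangle = 0$. The summand 1 in [C] allows division by [C] even if [z] is zero. *)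
have vz0 (v : 'I_n.+1 -> R) : (forall i, v i = a \/ v i = b) ->
    \sum_i v i * z 0 i = 0.
  move=> vab; apply/eqP; rewrite -normr_le0; apply/ler_addgt0Pl => e e0.
  rewrite addr0.
  pose C := 1 + \sum_i `|z 0 i|.
  have C0 : 0 < C by rewrite ltr_pwDl// sumr_ge0.
  have box := ball_box_gt0 (fun i => supp _ (vab i) _ (divr_gt0 e0 C0)).
  have [w [wbox wz]] : exists w,
      (forall i, ball (v i) (e / C) (X i w)) /\ lincomb X z w = 0.
    apply: contrapT => /forallNP nex; move: box; rewrite ltNge => /negP; apply.
    have [N [mN N0 XN]] := Xz0.
    rewrite -N0 le_measure ?inE//.
      apply: fin_bigcap_measurable => [|i _]; first exact: finite_finset.
      by apply: measurable_funPTI => //; exact: measurable_ball.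
    move=> w wbox; apply: XN => /= wz; apply: (nex w); split=> // i.
    exact: wbox.
  rewrite -[X in `|X|]subr0 -[X in _ - X]wz /lincomb -sumrB.
  apply: (@le_trans _ _ (\sum_i e / C * `|z 0 i|)).
    apply: (le_trans (ler_norm_sum _ _ _)); apply: ler_sum => i _.
    by rewrite -mulrBl normrM ler_wpM2r//; apply/ltW/wbox.
  rewrite -mulr_sumr -mulrA ger_pMr// ler_pdivrMl// mulr1.
  by rewrite lerDr.
apply/rowP => k; rewrite mxE.
(* Two vectors of support points are compared: [a] everywhere, and [a] everywhere except [b] at [k].
   Their difference isolates [(b - a) * z 0 k]. *)
pose r := \sum_(i | i != k) a * z 0 i.
have bk : b * z 0 k + r = 0.
  rewrite -[RHS](vz0 (fun i => if i == k then b else a)); last first.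
    by move=> i; case: eqP; [right|left].
  rewrite [RHS](bigD1 k)//= eqxx; congr (_ + _).
  by apply: eq_bigr => i /negPf->.
have ak : a * z 0 k + r = 0.
  rewrite -[RHS](vz0 (fun=> a)); last by left.
  by rewrite [RHS](bigD1 k).
have /eqP : (b - a) * z 0 k = 0.
  by apply/eqP; rewrite mulrBl subr_eq0; apply/eqP/(addIr r); rewrite bk ak.
by rewrite mulf_eq0 subr_eq0 [b == a]eq_sym (negPf ab) => /eqP.
Qed.

Lemma moment_eq0 (p : R) (z : 'rV[R]_n.+1) : 0 <= p ->
  (\int[P]_w ((`| X ord0 w | `^ p)%:E) < +oo)%E ->
  moment X p z = 0 -> z = 0.
Proof.
move=> p0 Xp Mz; apply: lincomb_ae_eq0.
have intz := integrable_lincomb hX p0 Xp z.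
have : (\int[P]_w `|(`|lincomb X z w| `^ p)%:E| = 0)%E.
  under eq_integral do rewrite gee0_abs ?lee_fin ?powR_ge0//.
  rewrite -[LHS]fineK ?integrable_fin_num//.
  by rewrite -[fine _]/(moment X p z) Mz.
move/ae_eq_integral_abs => -/(_ measurableT) H.
have {}H := H (measurable_int _ intz).
apply: filterS H => w /(_ I)[] /powR_eq0_eq0/eqP.
by rewrite normr_eq0 => /eqP.
Qed.

End definiteness.

(** * Duality *)

(** Young's inequality for $a$ and $b^{p-1}$ with exponents $p$ and $p/(p-1)$, multiplied by $p$.
    The case $p = 1$, which has no finite conjugate exponent, is an equality. *)
Lemma young_powR (R : realType) (p a b : R) : 1 <= p -> 0 <= a -> 0 <= b ->
  p * (b `^ (p - 1) * a) <= a `^ p + (p - 1) * b `^ p.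
Proof.
rewrite le_eqVlt => /predU1P[<-|p1] a0 b0.
  by rewrite subrr powRr0 !mul1r mul0r addr0 powRr1.
have p0 : 0 < p by rewrite (lt_trans ltr01).
have p10 : 0 < p - 1 by rewrite subr_gt0.
have bK : (b `^ (p - 1)) `^ (p / (p - 1)) = b `^ p.
  by rewrite -powRrM mulrCA divff ?gt_eqF// mulr1.
have pq : p^-1 + (p / (p - 1))^-1 = 1.
  by rewrite invf_div -{1}[p^-1]mul1r -mulrDl [1 + _]addrC subrK divff ?gt_eqF.
have := conjugate_powR a0 (powR_ge0 b (p - 1)) p0 (divr_gt0 p0 p10) pq.
rewrite bK invf_div -(ler_pM2l p0) mulrDr [p * (_ / p)]mulrCA divff ?gt_eqF//.
rewrite [p * (_ * (_ / p))]mulrCA [p * (_ / p)]mulrCA divff ?gt_eqF// !mulr1.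
by rewrite [b `^ _ * a]mulrC [(p - 1) * _]mulrC.
Qed.

(** The bound is best at $t = (A/B)^{1/p}$, where the right-hand side equals $pA$. This turns the
    additive Young bound into a multiplicative one of Hölder type. *)
Lemma powR_optimize (R : realType) (p A B L : R) : 1 <= p -> 0 < A -> 0 < B ->
  (forall t, 0 < t -> p * (t * L) <= t `^ p * B + (p - 1) * A) ->
  L <= A `^ (1 - p^-1) * B `^ p^-1.
Proof.
move=> p1 A0 B0 H; have p0 : 0 < p by exact: lt_le_trans p1.
have a0 : 0 < A `^ p^-1 by rewrite powR_gt0.
have b0 : 0 < B `^ p^-1 by rewrite powR_gt0.
have aK x : 0 < x -> (x `^ p^-1) `^ p = x.
  by move=> x0; rewrite -powRrM mulVf ?gt_eqF// powRr1// ltW.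
have bV : ((B `^ p^-1)^-1) `^ p = B^-1.
  by rewrite -(powR_inv1 (ltW b0)) powRAC aK// (powR_inv1 (ltW B0)).
have := H _ (divr_gt0 a0 b0).
have -> : (A `^ p^-1 / B `^ p^-1) `^ p * B + (p - 1) * A = p * A.
  rewrite powRM ?invr_ge0 ?(ltW a0) ?(ltW b0)//.
  by rewrite aK// bV mulfVK ?gt_eqF// mulrBl mul1r addrC subrK.
rewrite ler_pM2l// mulrAC ler_pdivrMr// -ler_pdivlMl// => /le_trans; apply.
rewrite powRB ?(gt_eqF A0) ?implybT//.
by rewrite powRr1 ?(ltW A0)// mulrA [_ * A]mulrC lexx.
Qed.

Lemma Rintegral_sum d (T : measurableType d) (R : realType)
    (mu : {measure set T -> \bar R}) (D : set T) (I : Type) (s : seq I)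
    (f : I -> T -> R) : measurable D ->
  (forall i, mu.-integrable D (EFin \o f i)) ->
  \int[mu]_(x in D) (\sum_(i <- s) f i x) = \sum_(i <- s) \int[mu]_(x in D) f i x.
Proof.
move=> mD fi; elim: s => [|i s IHs].
  under eq_Rintegral do rewrite big_nil.
  by rewrite Rintegral_cst// mul0r big_nil.
under eq_Rintegral do rewrite big_cons.
rewrite RintegralD// ?big_cons ?IHs//.
rewrite (_ : _ \o _ = fun x => \sum_(j <- s) (f j x)%:E)%E.
  by apply: integrable_sum => // j _; exact: fi.
by apply/funext => x /=; rewrite sumEFin.
Qed.

Lemma powR_le_add (R : realType) (p A b c : R) : 0 < A ->
  A <= A `^ (1 - p^-1) * b + A `^ (1 - p^-1) * c -> A `^ p^-1 <= b + c.
Proof.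
move=> A0; rewrite -mulrDr => H; rewrite -(@ler_pM2l _ (A `^ (1 - p^-1))) ?powR_gt0//.
by rewrite -powRD ?(gt_eqF A0) ?implybT// subrK (powRr1 (ltW A0)).
Qed.

Section duality.
Context d0 (Omega : measurableType d0) (R : realType) (P : probability Omega R).
Variables (n : nat) (X : 'I_n.+1 -> {RV P >-> R}).
Hypothesis hX : iid_random_vector P n X.
Variable p : R.
Hypothesis p1 : 1 <= p.
Hypothesis Xp : (\int[P]_w ((`| X ord0 w | `^ p)%:E) < +oo)%E.

Let p_gt0 : 0 < p. Proof. exact: lt_le_trans p1. Qed.
Let p_ge0 : 0 <= p. Proof. exact: ltW. Qed.

(* This is |Y|^(p-1) sgn Y for Y = <X, y>. *)
Let h (y : 'rV[R]_n.+1) w :=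
  lincomb X y w * `|lincomb X y w| `^ (p - 2).

(** Equality can fail where $Y = 0$: for $p = 1$ the right-hand side is then $0^0 = 1$, while the
    factor $Y$ makes the left-hand side zero. *)
Let normr_h y w : `|h y w| <= `|lincomb X y w| `^ (p - 1).
Proof.
rewrite normrM [X in _ * X]ger0_norm ?powR_ge0//.
have [->|Y0] := eqVneq (lincomb X y w) 0; first by rewrite normr0 mul0r powR_ge0.
rewrite -[X in X * _]powRr1// -powRD ?normr_eq0 ?Y0 ?implybT//.
by rewrite addrC -addrA (_ : -2 + 1 = -1)//; ring.
Qed.

(** Pointwise Young inequality, used twice: as the domination in [integrable_h] and, integrated, in
    [g_young]. *)
Let h_lincomb_le y z w : `|p * (h y w * lincomb X z w)| <=
  `|lincomb X z w| `^ p + (p - 1) * `|lincomb X y w| `^ p.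
Proof.
apply: le_trans (young_powR p1 (normr_ge0 _) (normr_ge0 _)).
by rewrite normrM gtr0_norm// ler_pM2l// normrM ler_wpM2r.
Qed.

Let measurable_h y : measurable_fun setT (h y).
Proof.
apply: measurable_funM; last exact/measurable_norm_powR/measurable_lincomb.
exact: measurable_lincomb.
Qed.

Let integrable_moment z : P.-integrable setT (EFin \o (fun w => `|lincomb X z w| `^ p)).
Proof. exact: integrable_lincomb. Qed.

Let integrable_young y z : P.-integrable setT
  (EFin \o (fun w => `|lincomb X z w| `^ p + (p - 1) * `|lincomb X y w| `^ p)).
Proof.
rewrite (_ : _ \o _ = (fun w => (`|lincomb X z w| `^ p)%:E +
    (p - 1)%:E * (`|lincomb X y w| `^ p)%:E)%E) => [|]; last by apply/funext.
apply: integrableD; [by []|exact: integrable_moment|].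
by apply: integrableZl => //; exact: integrable_moment.
Qed.

Let integrable_h y z : P.-integrable setT (EFin \o (fun w => h y w * lincomb X z w)).
Proof.
have mhz : measurable_fun setT (fun w => h y w * lincomb X z w).
  by apply: measurable_funM => //; exact: measurable_lincomb.
apply: le_integrable (integrable_young y z) => //; first exact/measurable_EFinP.
move=> w _; rewrite !abse_EFin lee_fin [leRHS]ger0_norm.
  apply: le_trans (h_lincomb_le y z w); rewrite [leRHS]normrM [`|p|]gtr0_norm//.
  by rewrite ler_peMl.
by rewrite addr_ge0 ?mulr_ge0 ?powR_ge0// subr_ge0.
Qed.

(** Up to the factor [p], this is formally the gradient of [moment X p] at [y]. *)
Let g y i := \int[P]_w (h y w * X i w).

Let lincomb_delta i w : lincomb X (delta_mx 0 i) w = X i w.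
Proof.
rewrite /lincomb (bigD1 i)//= mxE !eqxx mulr1 big1 ?addr0// => j ji.
by rewrite mxE eqxx/= (negPf ji) mulr0.
Qed.

Let gE y (z : 'rV[R]_n.+1) : \sum_i g y i * z 0 i = \int[P]_w (h y w * lincomb X z w).
Proof.
have ih i : P.-integrable setT (EFin \o (fun w => h y w * X i w)).
  apply: eq_integrable (integrable_h y (delta_mx 0 i)) => // w _ /=.
  by rewrite lincomb_delta.
under [RHS]eq_Rintegral do rewrite mulr_sumr.
rewrite Rintegral_sum//.
  apply: eq_bigr => i _; rewrite -RintegralZr//.
  by apply: eq_Rintegral => w _; rewrite mulrA.
move=> i; have := integrableZl measurableT (z 0 i) (ih i).
apply: eq_integrable => // w _ /=.
by rewrite -EFinM mulrC mulrA.
Qed.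

Let g_self (y : 'rV[R]_n.+1) : \sum_i g y i * y 0 i = moment X p y.
Proof.
rewrite gE; apply: eq_Rintegral => w _; rewrite /h mulrAC -expr2 -real_normK ?num_real//.
(* Adding the exponents $2$ and $p - 2$ is legitimate even where $Y = 0$, because their sum [p] is
   nonzero. *)
rewrite -powR_mulrn// -powRD; last by rewrite addrC subrK gt_eqF.
by rewrite addrC subrK.
Qed.

Let g_young y (z : 'rV[R]_n.+1) : p * \sum_i g y i * z 0 i <= moment X p z + (p - 1) * moment X p y.
Proof.
rewrite gE -RintegralZl//.
rewrite -[X in _ + X]RintegralZl// -RintegralD//; last first.
  exact: (integrableZl measurableT (p - 1) (integrable_moment y)).
apply: le_Rintegral => //; first exact: (integrableZl measurableT p (integrable_h y z)).
by move=> w _; apply: le_trans (h_lincomb_le y z w); exact: ler_norm.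
Qed.

Lemma momentZ (t : R) z : moment X p (t *: z) = `|t| `^ p * moment X p z.
Proof.
rewrite -RintegralZl//; apply: eq_Rintegral => w _.
rewrite -powRM// -normrM; congr (`|_| `^ p); rewrite /lincomb mulr_sumr.
by apply: eq_bigr => i _; rewrite mxE mulrCA.
Qed.

Lemma moment_perm (s : 'S_n.+1) (z : 'rV[R]_n.+1) :
  moment X p (\row_i z 0 (s i)) = moment X p z.
Proof. by rewrite /moment /Rintegral (integral_lincomb_perm hX). Qed.

Opaque moment.

(** Apply [g_young] to [t *: z] and optimise over [t]. This needs both moments positive: if that of
    [y] vanishes, [c = 0] works, and if that of [z] vanishes, then [z = 0] by definiteness. *)
Lemma moment_dual (y : 'rV[R]_n.+1) : exists2 c : 'I_n.+1 -> R,
  \sum_i c i * y 0 i = moment X p y &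
  forall z : 'rV[R]_n.+1, \sum_i c i * z 0 i <=
    moment X p y `^ (1 - p^-1) * moment X p z `^ p^-1.
Proof.
have [Fy0|Fy0] := eqVneq (moment X p y) 0.
  exists (fun=> 0) => [|z]; under eq_bigr do rewrite mul0r.
    by rewrite big1.
  by rewrite big1// mulr_ge0 ?powR_ge0.
exists (g y) => // z.
have [Fz0|Fz0] := eqVneq (moment X p z) 0.
  rewrite (moment_eq0 hX p_ge0 Xp Fz0).
  rewrite big1 ?mulr_ge0 ?powR_ge0// => i _.
  by rewrite mxE mulr0.
have {}Fy0 : 0 < moment X p y by rewrite lt_def Fy0 moment_ge0.
have {}Fz0 : 0 < moment X p z by rewrite lt_def Fz0 moment_ge0.
apply: (powR_optimize p1 Fy0 Fz0) => t t0.
rewrite -[t in t `^ p](gtr0_norm t0) -momentZ; apply: le_trans (g_young y _).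
rewrite le_eqVlt mulr_sumr; apply/orP; left; apply/eqP; congr (p * _).
by apply: eq_bigr => i _; rewrite mxE mulrCA.
Qed.

Lemma moment_norm_triangle (y a b : 'rV[R]_n.+1) (S T : 'M[R]_n.+1) :
  doubly_stochastic S -> doubly_stochastic T ->
  (forall i, y 0 i = \sum_j S i j * a 0 j + \sum_j T i j * b 0 j) ->
  moment X p y `^ p^-1 <= moment X p a `^ p^-1 + moment X p b `^ p^-1.
Proof.
move=> dS dT yE.
have [Fy0|Fy0] := eqVneq (moment X p y) 0.
  by rewrite Fy0 powR0 ?invr_eq0 ?gt_eqF// addr_ge0 ?powR_ge0.
have {}Fy0 : 0 < moment X p y by rewrite lt_def Fy0 moment_ge0.
have [c cy cle] := moment_dual y.
have perm_le (U : 'M[R]_n.+1) (z : 'rV[R]_n.+1) : doubly_stochastic U ->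
    \sum_i c i * (\sum_j U i j * z 0 j) <=
    moment X p y `^ (1 - p^-1) * moment X p z `^ p^-1.
  move=> dU; have [s sle] := doubly_stochastic_rearrangement c (z 0) dU.
  under eq_bigr do rewrite mulr_sumr; under eq_bigr do under eq_bigr do rewrite mulrA.
  apply: (le_trans sle).
  rewrite -(moment_perm s z); apply: le_trans (cle _).
  rewrite le_eqVlt; apply/orP; left; apply/eqP.
  by apply: eq_bigr => i _; rewrite mxE.
apply: (powR_le_add Fy0).
apply: le_trans (lerD (perm_le S a dS) (perm_le T b dT)).
rewrite -big_split/= -{1}cy le_eqVlt; apply/orP; left; apply/eqP.
by apply: eq_bigr => i _; rewrite yE mulrDr.
Qed.

End duality.

(** * Continuity in the exponent *)

Section continuity_of_moments.
Variable R : realType.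

(* Clamping exponents to [1, m] turns continuity within [1, m] into continuity on
   the whole line, so that dominated convergence applies around every point. *)
Definition clamp (m d : R) : R := Num.max 1 (Num.min d m).

Lemma clamp_id m d : 1 <= d -> d <= m -> clamp m d = d.
Proof. by move=> d1 dm; rewrite /clamp (min_idPl dm) (max_idPr d1). Qed.

Lemma clamp_ge1 m d : 1 <= clamp m d.
Proof. by rewrite /clamp le_max lexx. Qed.

Lemma clamp_gt0 m d : 0 < clamp m d.
Proof. exact: lt_le_trans (clamp_ge1 m d). Qed.

Lemma clamp_le m d : 1 <= m -> clamp m d <= m.
Proof. by move=> m1; rewrite /clamp ge_max m1 ge_min lexx orbT. Qed.

Lemma continuous_clamp m : continuous (clamp m).
Proof.
move=> d; apply: (@continuous_max _ _ (cst 1) (fun d => Num.min d m)).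
  exact: cst_continuous.
by apply: (@continuous_min _ _ idfun (cst m)); [exact: cvg_id|exact: cst_continuous].
Qed.

(** Supplies a dominating function independent of the exponent [c]. *)
Lemma powR_le1D (a c m : R) : 0 <= a -> 0 < c -> c <= m -> a `^ c <= 1 + a `^ m.
Proof.
move=> a0 c0 cm; have [a1|a1] := lerP 1 a.
  by rewrite ler_wpDl// ler_powR.
rewrite ler_wpDr ?powR_ge0//.
have [->|an0] := eqVneq a 0; first by rewrite powR0 ?gt_eqF.
by rewrite -(powRr0 a) ger_powR ?ltW// lt_def an0 a0.
Qed.

Lemma continuous_powR_clamp m (a : R) : 0 <= a ->
  continuous (fun d => a `^ clamp m d).
Proof.
move=> a0 d; have [->|an0] := eqVneq a 0.
  rewrite (_ : (fun _ => _) = cst 0); first exact: cst_continuous.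
  by apply/funext => x; rewrite powR0 ?gt_eqF ?clamp_gt0.
rewrite (_ : (fun _ => _) = expR \o (fun d => clamp m d * ln a)).
  apply: continuous_comp; last exact: continuous_expR.
  by apply: continuousM; [exact: continuous_clamp|exact: cst_continuous].
by apply/funext => x; rewrite /powR (negPf an0).
Qed.

(** The weight [k] lets one statement serve both the moments, with [k = 1], and the gamma integral,
    with $k(t) = e^{-t}$. *)
Lemma integrable_powR_clamp d (T : measurableType d)
    (mu : {measure set T -> \bar R}) (B : set T) (a k : T -> R) (m : R) :
  1 <= m -> measurable B ->
  measurable_fun B a -> (forall y, B y -> 0 <= a y) ->
  (forall y, B y -> 0 <= k y) -> mu.-integrable B (EFin \o k) ->
  mu.-integrable B (EFin \o (fun y => a y `^ m * k y)) ->
  forall c, mu.-integrable B (EFin \o (fun y => a y `^ clamp m c * k y)).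
Proof.
move=> m1 mB ma a0 k0 ik imk c.
have mk : measurable_fun B k by apply/measurable_EFinP; exact: measurable_int ik.
apply: le_integrable (integrableD mB ik imk) => //.
  apply/measurable_EFinP; apply: measurable_funM => //.
  exact: (measurableT_comp (measurable_powR _)).
move=> y By /=; rewrite lee_fin.
rewrite !ger0_norm ?addr_ge0 ?mulr_ge0 ?powR_ge0 ?k0//.
rewrite -{2}[k y]mul1r -mulrDl ler_wpM2r ?k0//.
by rewrite powR_le1D ?a0 ?clamp_gt0 ?clamp_le.
Qed.

Lemma continuous_Rintegral_powR_clamp d (T : measurableType d)
    (mu : {measure set T -> \bar R}) (B : set T) (a k : T -> R) (m : R) :
  1 <= m -> measurable B ->
  measurable_fun B a -> (forall y, B y -> 0 <= a y) ->
  (forall y, B y -> 0 <= k y) -> mu.-integrable B (EFin \o k) ->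
  mu.-integrable B (EFin \o (fun y => a y `^ m * k y)) ->
  continuous (fun c => \int[mu]_(y in B) (a y `^ clamp m c * k y)).
Proof.
move=> m1 mB ma a0 k0 ik imk c.
(* Any open interval around [c] would do, since after clamping the domination holds for every real
   exponent. *)
apply: (@continuity_under_integral _ _ _ mu
  (fun c y => a y `^ clamp m c * k y) B mB (c - 1) (c + 1) _ _
  (fun y => k y + a y `^ m * k y)).
- by move=> x _; exact: integrable_powR_clamp.
- apply: aeW => y By x _.
  exact: (cvgM (@continuous_powR_clamp m _ (a0 y By) x) (cvg_cst (k y))).
- exact: (integrableD mB ik imk).
- move=> x _; apply: aeW => y By.
  rewrite !ger0_norm ?mulr_ge0 ?powR_ge0 ?k0//.
  rewrite -{2}[k y]mul1r -mulrDl ler_wpM2r ?k0//.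
  by rewrite powR_le1D ?a0 ?clamp_gt0 ?clamp_le.
- by rewrite inE/= in_itv/= ltrBlDr ltrDl ltr01.
Qed.

Lemma integrable_expRN (r : R) : 0 < r ->
  lebesgue_measure.-integrable `]0%R, +oo[%classic (EFin \o (fun t : R => expR (- r * t))).
Proof.
move=> r0; have ie := integrable_exponential_pdf r0.
have : lebesgue_measure.-integrable `]0%R, +oo[%classic
    (fun x => r^-1%:E * (exponential_pdf r x)%:E)%E.
  by apply: integrableZl => //; exact: integrableS ie.
apply: eq_integrable => // t; rewrite inE/= in_itv/= andbT => t0.
by rewrite -EFinM exponential_pdfE ?ltW// mulrA mulVf ?gt_eqF// mul1r.
Qed.

(** Raise $t \le 2m\,e^{t/(2m)}$, a consequence of $1 + x \le e^x$, to the power $m$. The rate $1/2$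
    leaves an integrable $e^{-t/2}$ after multiplication by $e^{-t}$. *)
Lemma powR_le_expR (m t : R) : 0 < m -> 0 <= t ->
  t `^ m <= (2 * m) `^ m * expR (2^-1 * t).
Proof.
move=> m0 t0; have m20 : 0 < 2 * m by rewrite mulr_gt0.
have tm : t <= (2 * m) * expR (t / (2 * m)).
  rewrite -ler_pdivrMl// mulrC; apply: le_trans (expR_ge1Dx _).
  by rewrite lerDr.
apply: (@le_trans _ _ ((2 * m * expR (t / (2 * m))) `^ m)).
  by rewrite (ge0_ler_powR (ltW m0))// nnegrE mulr_ge0 ?expR_ge0// ltW.
rewrite (powRM _ (ltW m20) (expR_ge0 _)) ler_wpM2l ?powR_ge0//.
rewrite -expRM (_ : t / (2 * m) * m = 2^-1 * t)//.
by field; rewrite gt_eqF.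
Qed.

Let gamma_integrand_ge0 (m t : R) : 0 <= t `^ m * expR (- t).
Proof. by rewrite mulr_ge0 ?powR_ge0 ?expR_ge0. Qed.

Let measurable_gamma (m : R) :
  measurable_fun (`]0%R, +oo[%classic : set R) (fun t : R => t `^ m * expR (- t)).
Proof.
apply: measurable_funM; first exact: measurable_funTS (measurable_powR _).
by apply: measurableT_comp => //; exact: measurable_funTS.
Qed.

Lemma integrable_gamma (m : R) : 0 < m ->
  lebesgue_measure.-integrable `]0%R, +oo[%classic
    (EFin \o (fun t : R => t `^ m * expR (- t))).
Proof.
move=> m0; have half0 : 0 < 2^-1 :> R by rewrite invr_gt0.
have : lebesgue_measure.-integrable `]0%R, +oo[%classic
    (fun t : R => ((2 * m) `^ m)%:E * (expR (- 2^-1 * t))%:E)%E.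
  by apply: integrableZl => //; exact: integrable_expRN.
apply: le_integrable => //; first by apply/measurable_EFinP; exact: measurable_gamma.
move=> t; rewrite /= in_itv/= andbT => t0; rewrite lee_fin.
rewrite ger0_norm// ger0_norm ?mulr_ge0 ?powR_ge0 ?expR_ge0//.
apply: le_trans (ler_wpM2r (expR_ge0 _) (powR_le_expR m0 (ltW t0))) _.
rewrite -mulrA -expRD (_ : 2^-1 * t + - t = - 2^-1 * t)//; by field.
Qed.

Lemma GammaE (s : R) : Gamma (s + 1) =
  \int[lebesgue_measure]_(t in `]0%R, +oo[%classic) (t `^ s * expR (- t)).
Proof. by rewrite /Gamma addrK. Qed.

(** If the integral vanished, the integrand would be zero almost everywhere; being nonzero at every
    $t > 0$, it would force the half-line to be null. *)
Lemma Gamma_gt0 (s : R) : 0 < s -> 0 < Gamma (s + 1).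
Proof.
move=> s0; have ig := integrable_gamma s0.
rewrite GammaE lt_def Rintegral_ge0 ?andbT; last by move=> t _.
apply/eqP => G0.
have : (\int[lebesgue_measure]_(t in `]0%R, +oo[%classic)
    `|(t `^ s * expR (- t))%:E| = 0)%E.
  under eq_integral do rewrite gee0_abs ?lee_fin//.
  by rewrite -[LHS]fineK ?integrable_fin_num// -[fine _]/(Rintegral _ _ _) G0.
move/ae_eq_integral_abs => -/(_ (measurable_itv _)) H.
have [N [mN N0 HN]] := H (measurable_int _ ig).
have : (lebesgue_measure (`]0%R, +oo[%classic : set R) <= lebesgue_measure N)%E.
  rewrite le_measure ?inE//; apply: subset_trans HN => t /= t0 /(_ t0)[] /eqP.
  rewrite mulf_eq0 [expR _ == 0]gt_eqF ?expR_gt0// orbF powR_eq0 => /andP[/eqP tE _].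
  by move: t0; rewrite tE in_itv/= ltxx.
by rewrite N0 lebesgue_measure_itv/= ltry/= leye_eq.
Qed.

Lemma continuous_Gamma_clamp m : 1 <= m ->
  continuous (fun d => Gamma (clamp m d + 1) : R).
Proof.
move=> m1; rewrite (_ : (fun _ => _) = fun c =>
    \int[lebesgue_measure]_(t in `]0%R, +oo[%classic) (t `^ clamp m c * expR (- t))).
  apply: continuous_Rintegral_powR_clamp => //.
  - by move=> t; rewrite /= in_itv/= andbT => /ltW.
  - have := @integrable_expRN 1 ltr01; apply: eq_integrable => // t _ /=.
    by rewrite mulN1r.
  - by apply: integrable_gamma; exact: lt_le_trans m1.
by apply/funext => c; rewrite GammaE.
Qed.

(** Positivity of the base allows the power to be written as [expR] of a product with [ln]. *)
Lemma continuous_powR_ratio m (F G : R -> R) :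
  continuous F -> continuous G -> (forall d, 0 < F d) -> (forall d, 0 < G d) ->
  continuous (fun d => (F d / G d) `^ (clamp m d)^-1).
Proof.
move=> cF cG F0 G0 d.
rewrite (_ : (fun _ => _) =
    expR \o (fun d => (clamp m d)^-1 * ln (F d / G d))).
  apply: continuous_comp; last exact: continuous_expR.
  apply: cvgM.
    by apply: cvgV; [rewrite gt_eqF ?clamp_gt0|exact: continuous_clamp].
  apply: continuous_cvg; first by apply: continuous_ln; rewrite divr_gt0.
  apply: cvgM; first exact: cF.
  by apply: cvgV; [rewrite gt_eqF|exact: cG].
by apply/funext => x; rewrite /powR gt_eqF ?divr_gt0.
Qed.

End continuity_of_moments.

(** * The norm *)

Lemma powR_ratio_le (R : realType) (a b c g q : R) :
  0 <= a -> 0 <= b -> 0 <= c -> 0 <= g -> a `^ q <= b `^ q + c `^ q ->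
  (a / g) `^ q <= (b / g) `^ q + (c / g) `^ q.
Proof.
move=> a0 b0 c0 g0 abc.
by rewrite !powRM ?invr_ge0// -mulrDl ler_wpM2r ?powR_ge0.
Qed.

Section Xnorm_properties.
Context d0 (Omega : measurableType d0) (R : realType) (P : probability Omega R).
Variables (n : nat) (X : 'I_n.+1 -> {RV P >-> R}).
Hypothesis hX : iid_random_vector P n X.

Lemma XnormE p (A : 'M[R[i]]_n.+1) :
  Xnorm P n.+1 X p A = (moment X p (eigvals n.+1 A) / Gamma (p + 1)) `^ p^-1.
Proof. by []. Qed.

(** By exchangeability the order of the eigenvalues is irrelevant, so any unitary diagonalisation
    can replace the sorted vector [eigvals]. *)
Lemma Xnorm_unitary_diag p (A U : 'M[R[i]]_n.+1) (x : 'rV[R]_n.+1) :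
  U \is unitarymx -> A = U^t* *m diag_mx (map_mx RtoC x) *m U ->
  Xnorm P n.+1 X p A = (moment X p x / Gamma (p + 1)) `^ p^-1.
Proof.
move=> Uu AE; have [s sx] := eigvals_unitary_diag Uu AE.
rewrite XnormE (_ : eigvals _ _ = \row_i x 0 (s i)) ?moment_perm//.
by apply/rowP => i; rewrite mxE sx.
Qed.

Lemma Xnorm_unitary_conj p : weakly_unitarily_invariant n.+1 (Xnorm P n.+1 X p).
Proof. by move=> A U _ Uu; rewrite !XnormE eigvals_unitary_conj. Qed.

Section fixed_exponent.
Variable p : R.
Hypothesis p1 : 1 <= p.
Hypothesis Xp : (\int[P]_w ((`| X ord0 w | `^ p)%:E) < +oo)%E.

Let p_gt0 : 0 < p. Proof. exact: lt_le_trans p1. Qed.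
Let G_gt0 : 0 < Gamma (p + 1). Proof. exact: Gamma_gt0. Qed.

Lemma Xnorm_eq0 A : A \is hermsymmx -> Xnorm P n.+1 X p A = 0 -> A = 0.
Proof.
move=> /hermitian_unitary_diag[U [x [Uu AE]]].
rewrite (Xnorm_unitary_diag p Uu AE) => /powR_eq0_eq0/eqP.
rewrite mulf_eq0 invr_eq0 (gt_eqF G_gt0) orbF => /eqP/(moment_eq0 hX (ltW p_gt0) Xp) x0.
rewrite AE x0 (_ : map_mx RtoC 0 = 0); last by apply/rowP => j; rewrite !mxE.
by rewrite raddf0 mulmx0 mul0mx.
Qed.

Lemma XnormZ (a : R) A : A \is hermsymmx ->
  Xnorm P n.+1 X p (RtoC a *: A) = `|a| * Xnorm P n.+1 X p A.
Proof.
move=> /hermitian_unitary_diag[U [x [Uu AE]]].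
(* A negative [a] reverses the order of the eigenvalues, which is harmless because
   [Xnorm_unitary_diag] accepts any order. *)
have aAE : RtoC a *: A = U^t* *m diag_mx (map_mx RtoC (a *: x)) *m U.
  rewrite AE (_ : diag_mx (map_mx RtoC (a *: x)) =
      RtoC a *: diag_mx (map_mx RtoC x)) -?scalemxAr -?scalemxAl//.
  apply/matrixP => i j; rewrite !mxE [RHS]mulrnAr; congr (_ *+ _).
  exact: (rmorphM (real_complex R)).
rewrite (Xnorm_unitary_diag p Uu AE) (Xnorm_unitary_diag p Uu aAE).
rewrite (momentZ hX p1 Xp) -mulrA powRM ?powR_ge0 ?divr_ge0 ?moment_ge0 ?(ltW G_gt0)//.
by rewrite -powRrM divff ?(gt_eqF p_gt0)// powRr1.
Qed.

Lemma Xnorm_triangle A B : A \is hermsymmx -> B \is hermsymmx ->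
  Xnorm P n.+1 X p (A + B) <= Xnorm P n.+1 X p A + Xnorm P n.+1 X p B.
Proof.
move=> Ah Bh.
have ABh : A + B \is hermsymmx.
  apply/is_hermitianmxP; rewrite [_^T]linearD/= map_mxD scalerDr.
  by rewrite -(is_hermitianmxP _ _ _ Ah) -(is_hermitianmxP _ _ _ Bh).
have [U [y [Uu ABE]]] := hermitian_unitary_diag ABh.
have [V [a [Vu AE]]] := hermitian_unitary_diag Ah.
have [W [b [Wu BE]]] := hermitian_unitary_diag Bh.
rewrite (Xnorm_unitary_diag p Uu ABE) (Xnorm_unitary_diag p Vu AE).
rewrite (Xnorm_unitary_diag p Wu BE).
apply: powR_ratio_le; rewrite ?moment_ge0 ?(ltW G_gt0)//.
move: ABE; rewrite AE BE => /(unitary_diag_add Uu Vu Wu)[S [T [dS dT yE]]].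
exact: (moment_norm_triangle hX p1 Xp dS dT yE).
Qed.

Lemma is_norm_Xnorm : is_norm_on_H n.+1 (Xnorm P n.+1 X p).
Proof.
split; [by move=> A _; exact: powR_ge0|exact: Xnorm_eq0|exact: XnormZ|].
exact: Xnorm_triangle.
Qed.

End fixed_exponent.

Lemma moment0 p : p != 0 -> moment X p 0 = 0.
Proof.
move=> p0; rewrite /moment; under eq_Rintegral => w _.
  rewrite /lincomb big1 ?normr0 ?powR0//; last by move=> i _; rewrite mxE mulr0.
  over.
by rewrite Rintegral_cst// mul0r.
Qed.

Lemma continuous_moment_clamp (m : R) z : 1 <= m ->
  (\int[P]_w ((`| X ord0 w | `^ m)%:E) < +oo)%E ->
  continuous (fun d => moment X (clamp m d) z).
Proof.
move=> m1 Xm; have m0 : 0 <= m by exact: le_trans m1.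
rewrite (_ : (fun _ => _) = fun c =>
    \int[P]_w (`|lincomb X z w| `^ clamp m c * cst 1 w)).
  apply: continuous_Rintegral_powR_clamp => //.
  - by apply: measurableT_comp => //; exact: measurable_lincomb.
  - exact: finite_measure_integrable_cst.
  - apply: eq_integrable (integrable_lincomb hX m0 Xm z) => // w _ /=.
    by rewrite mulr1.
by apply/funext => c; apply: eq_Rintegral => w _; rewrite mulr1.
Qed.

Lemma continuous_Xnorm (m : R) A : 1 <= m ->
  (\int[P]_w ((`| X ord0 w | `^ m)%:E) < +oo)%E ->
  {within `[1, m]%classic, continuous (fun d : R => Xnorm P n.+1 X d A)}.
Proof.
move=> m1 Xm; pose z := eigvals n.+1 A.
pose K d := (moment X (clamp m d) z / Gamma (clamp m d + 1)) `^ (clamp m d)^-1.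
apply: (@subspace_eq_continuous _ _ _ K).
  move=> d; rewrite inE/= in_itv/= => /andP[d1 dm]; rewrite /K clamp_id//; exact/esym/XnormE.
apply: continuous_subspaceT.
(* For [z = 0] the base of the power is zero and [continuous_powR_ratio] does not apply, but [K] is
   then constantly zero. Otherwise definiteness keeps the moment positive at every clamped
   exponent. *)
have [z0|zn0] := eqVneq z 0.
  rewrite (_ : K = cst 0); first exact: cst_continuous.
  apply/funext => d; rewrite /K z0 moment0 ?gt_eqF ?clamp_gt0// mul0r powR0//.
  by rewrite invr_eq0 gt_eqF ?clamp_gt0.
apply: continuous_powR_ratio.
- exact: continuous_moment_clamp.
- exact: continuous_Gamma_clamp.
- move=> d; rewrite lt_def moment_ge0 andbT; apply: contra_neq zn0.
  apply: (moment_eq0 hX); first exact/ltW/clamp_gt0.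
  have /integrableP[_] : P.-integrable setT
      (EFin \o (fun w => `|X ord0 w| `^ clamp m d * cst 1 w)).
    apply: integrable_powR_clamp => //.
    - by apply: measurableT_comp => //; exact: measurable_funP.
    - exact: finite_measure_integrable_cst.
    - have := integrable_powR hX Xm ord0.
      by apply: eq_integrable => // w _ /=; rewrite mulr1.
  by under eq_integral do rewrite /= mulr1 ger0_norm ?powR_ge0//.
- by move=> d; apply: Gamma_gt0; exact: clamp_gt0.
Qed.

End Xnorm_properties.

Theorem theorem2 (d0 : measure_display) (Omega : measurableType d0)
  (R : realType) (P : probability Omega R) (n : nat)
  (X : 'I_n.+1 -> {RV P >-> R})
  (hX : iid_random_vector P n X) :
  (forall d : R, 1 <= d ->
     (\int[P]_w ((`| X ord0 w | `^ d)%:E) < +oo)%E ->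
     is_norm_on_H n.+1 (Xnorm P n.+1 X d) /\
     weakly_unitarily_invariant n.+1 (Xnorm P n.+1 X d)) /\
  (forall m : R, 1 <= m ->
     (\int[P]_w ((`| X ord0 w | `^ m)%:E) < +oo)%E ->
     forall A : 'M[R[i]]_n.+1, A \is hermsymmx ->
       {within `[1, m]%classic, continuous (fun d : R => Xnorm P n.+1 X d A)}).
Proof.
split=> [d d1 Xd|m m1 Xm A _]; last exact: continuous_Xnorm.
by split; [exact: is_norm_Xnorm|exact: Xnorm_unitary_conj].
Qed.
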